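(* Let $G$ be a Polish group and let $\varphi(\bar{x},\bar{y})$ be a quantifier-free formula in the language of group theory, where $\bar{x},\bar{y}$ are finite tuples of variables. Then $\varphi(\bar{x},\bar{y})$ does not define the $\aleph_1$-half graph in $G$; that is, there do not exist sequences $(\bar{a}_\alpha : \alpha<\aleph_1)$ and $(\bar{b}_\beta : \beta<\aleph_1)$ of tuples of elements of $G$, with $\bar{a}_\alpha$ of the length of $\bar{x}$ and $\bar{b}_\beta$ of the length of $\bar{y}$, such that for all $\alpha,\beta<\aleph_1$: $G\models\varphi(\bar{a}_\alpha,\bar{b}_\beta)$ if and only if $\alpha<\beta$.
   Context: The $\aleph_1$-half graph $\Gamma(\aleph_1)$ is the graph on vertex set $\{a_\alpha : \alpha<\aleph_1\}\cup\{b_\beta : \beta<\aleph_1\}$ with edge relation $a_\alpha \mathrel{E} b_\beta$ if and only if $\alpha<\beta$. The language of group theory is $\{e,\cdot,(\ )^{-1}\}$. A Polish group is a topological group whose topology is separable and completely metrizable. *)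

(* Defs.v *)
From HB Require Import structures.
From mathcomp Require Import all_boot all_order all_algebra.
From mathcomp Require Import all_classical all_reals topology.
From mathcomp Require Import wochoice.

Set Implicit Arguments.
Unset Strict Implicit.
Unset Printing Implicit Defensive.

Import Order.TTheory GRing.Theory Num.Theory.

Local Open Scope classical_set_scope.
Local Open Scope ring_scope.

(* The library's topological groups are additive and abelian
   (topologicalZmodType), hence this multiplicative counterpart. *)
HB.mixin Record isTopologicalGroup G & Topological G & Group G := {
  mulg_continuous : continuous (fun z : G * G => (z.1 * z.2)%g);
  invg_continuous : continuous (fun x : G => (x^-1)%g)
}.

#[short(type="topologicalGroupType")]
HB.structure Definition TopologicalGroup :=
  {G of Topological G & Group G & isTopologicalGroup G}.

Definition separable (T : topologicalType) : Prop :=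
  exists2 D : set T, countable D & dense D.

Record is_metric (R : realType) (T : Type) (d : T -> T -> R) : Prop := IsMetric {
  is_metric_ge0 : forall x y, 0 <= d x y;
  is_metric_eq0 : forall x y, d x y = 0 <-> x = y;
  is_metric_sym : forall x y, d x y = d y x;
  is_metric_triangle : forall x y z, d x z <= d x y + d y z
}.

Definition metric_induces_topology (R : realType) (T : topologicalType)
    (d : T -> T -> R) : Prop :=
  forall x : T,
    nbhs x = filter_from [set e : R | 0 < e] (fun e => [set y | d x y < e]).

Definition metric_complete (R : realType) (T : topologicalType)
    (d : T -> T -> R) : Prop :=
  forall u : nat -> T,
    (forall e : R, 0 < e ->
       exists N : nat, forall i j, (N <= i)%N -> (N <= j)%N -> d (u i) (u j) < e) ->
    exists l : T, u @ \oo --> l.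

Definition completely_metrizable (R : realType) (T : topologicalType) : Prop :=
  exists d : T -> T -> R,
    [/\ is_metric d, metric_induces_topology d & metric_complete d].

Definition polish (R : realType) (T : topologicalType) : Prop :=
  separable T /\ completely_metrizable R T.

Inductive gterm (V : Type) : Type :=
| TVar of V
| TOne
| TMul of gterm V & gterm V
| TInv of gterm V.

Inductive qf_formula (V : Type) : Type :=
| QFalse
| QEq of gterm V & gterm V
| QNot of qf_formula V
| QAnd of qf_formula V & qf_formula V
| QOr of qf_formula V & qf_formula V
| QImp of qf_formula V & qf_formula V.

Arguments TOne {V}.
Arguments QFalse {V}.

Fixpoint geval (G : groupType) (V : Type) (v : V -> G) (t : gterm V) : G :=
  match t with
  | TVar x => v x
  | TOne => 1%g
  | TMul t1 t2 => (geval v t1 * geval v t2)%g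
  | TInv t1 => ((geval v t1)^-1)%g
  end.

Fixpoint qf_holds (G : groupType) (V : Type) (v : V -> G)
    (f : qf_formula V) : Prop :=
  match f with
  | QFalse => False
  | QEq t1 t2 => geval v t1 = geval v t2
  | QNot f1 => ~ qf_holds v f1
  | QAnd f1 f2 => qf_holds v f1 /\ qf_holds v f2
  | QOr f1 f2 => qf_holds v f1 \/ qf_holds v f2
  | QImp f1 f2 => qf_holds v f1 -> qf_holds v f2
  end.

(* In a formula phi(x, y) the variables in the tuple x (of length n) are the
   inl i, and those in the tuple y (of length m) are the inr j. *)
Definition valuation (G : Type) (n m : nat) (a : n.-tuple G) (b : m.-tuple G)
    (x : 'I_n + 'I_m) : G :=
  match x with inl i => tnth a i | inr j => tnth b j end.

(* W is ordered in type omega_1, the least uncountable ordinal: the order is a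
   well-order, W is uncountable, and all proper initial segments are
   countable. This determines W up to a unique order isomorphism. *)
Definition is_omega1 (d : Order.disp_t) (W : orderType d) : Prop :=
  [/\ well_order (<=%O : rel W),
      ~ countable [set: W]
    & forall w : W, countable [set v : W | (v < w)%O]].

Definition defines_half_graph (d : Order.disp_t) (W : orderType d)
    (G : groupType) (n m : nat) (phi : qf_formula ('I_n + 'I_m)) : Prop :=
  exists (a : W -> n.-tuple G) (b : W -> m.-tuple G),
    forall alpha beta : W,
      qf_holds (valuation (a alpha) (b beta)) phi <-> (alpha < beta)%O.

(* Main.v *)
(* The argument uses only that G is Hausdorff and second countable.  A
   quantifier-free formula is a finite Boolean combination of closed
   conditions, so every nonempty set of valuations has a nonempty relatively
   open subset on which the formula is constant.  For all but countably many
   indices w, every neighbourhood of a_w contains uncountably many terms of the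
   sequence a, and similarly for b.  Apply the first fact to the valuations
   (a_alpha, b_beta) with alpha, beta among these indices: the formula is
   constant on a box that contains uncountably many a_alpha and uncountably
   many b_beta, hence pairs with alpha < beta and pairs with beta <= alpha. *)
Require Import Defs.
From mathcomp Require Import all_boot all_order all_classical all_reals.
From mathcomp Require Import all_algebra topology.

Set Implicit Arguments.
Unset Strict Implicit.
Unset Printing Implicit Defensive.

Import Order.TTheory GRing.Theory Num.Theory.

Local Open Scope classical_set_scope.

Lemma metric_ball_nbhs (R : realType) (T : topologicalType) (d : T -> T -> R) (x : T) (e : R) :
  metric_induces_topology d -> (0 < e)%R -> nbhs x [set y | (d x y < e)%R].
Proof. by move=> dT e0; rewrite dT; exists e. Qed.

Lemma metric_separated (R : realType) (T : topologicalType) (d : T -> T -> R) (x y : T) :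
  is_metric d -> metric_induces_topology d -> x <> y ->
  exists A B, [/\ nbhs x A, nbhs y B & forall z, A z -> B z -> False].
Proof.
move=> dm dT xy.
have d0 : (0 < d x y)%R.
  rewrite lt_def is_metric_ge0// andbT; apply/eqP => /(is_metric_eq0 dm).
  exact: xy.
have e0 : (0 < d x y / 2)%R by rewrite divr_gt0.
exists [set z | (d x z < d x y / 2)%R], [set z | (d y z < d x y / 2)%R].
split; [exact: metric_ball_nbhs | exact: metric_ball_nbhs |] => z /= xz yz.
have := is_metric_triangle dm x z y; rewrite (is_metric_sym dm z y).
apply/negP; rewrite -ltNge (splitr (d x y)%R).
exact: ltrD.
Qed.

(** A countable network: unlike in a countable base, the sets [B k] need not be open. *)
Definition is_network (T : topologicalType) (B : nat -> set T) : Prop :=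
  forall x A, nbhs x A -> exists2 k, B k x & B k `<=` A.

Lemma separable_metric_network (R : realType) (T : topologicalType) (d : T -> T -> R) :
  is_metric d -> metric_induces_topology d -> separable T ->
  exists B : nat -> set T, is_network B.
Proof.
move=> dm dT [D /countable_injP[f f_inj] Dd].
(* The number [k] codes a centre in [D], through the injection [f], and a radius; a [k] that codes
   nothing gives the empty set. *)
exists (fun k => [set y | exists p i, [/\ D p, unpickle k = Some (f p, i) &
  (d p y < i.+1%:R^-1)%R]]) => x A.
rewrite dT => -[e /= e0 eA].
have [i] : exists i : nat, (0 + i.+1%:R^-1 < e / 2)%R.
  by apply: ltr_add_invr; rewrite divr_gt0.
rewrite add0r => ie.
have i0 : (0 < i.+1%:R^-1 :> R)%R by rewrite invr_gt0.
have [|p [xp Dp]] := Dd _ _ (open_interior [set y | (d x y < i.+1%:R^-1)%R]).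
  by exists x; exact: metric_ball_nbhs.
have {}xp := interior_subset xp.
exists (pickle (f p, i)).
  by exists p, i; split=> //; rewrite ?pickleK// (is_metric_sym dm).
move=> y [q [j [Dq]]]; rewrite pickleK => -[fpq <-] qy.
have /esym pq : p = q by apply: f_inj => //; exact/mem_set.
apply: eA => /=; apply: le_lt_trans (is_metric_triangle dm x p y) _.
rewrite (splitr e) ltrD//; first exact: lt_trans ie.
by rewrite -pq; exact: lt_trans ie.
Qed.

Section LocalDecidability.
Variables (G : topologicalGroupType) (V : Type).
Implicit Types (v : V -> G) (N : V -> set G).

Lemma geval_nbhs v (t : gterm V) (A : set G) : nbhs (geval v t) A ->
  exists2 N, (forall x, nbhs (v x) (N x)) &
    forall v', (forall x, N x (v' x)) -> A (geval v' t).
Proof.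
elim: t A => [x A vA|A A1|s IHs t IHt A|t IHt A] /=.
(* This box is [A] at [x] and all of [G] elsewhere, written without a test for equality on [V]. *)
- exists (fun y => [set z | y = x -> A z]); last by move=> v' /(_ x)/(_ erefl).
  move=> y; have [->|yx] := pselect (y = x); first by apply: filterS vA => z Az _.
  by apply: filterS filterT => z _ /yx.
- exists (fun=> setT) => [x|v' _]; [exact: filterT|exact: nbhs_singleton].
- move=> /(@mulg_continuous G (geval v s, geval v t))[[B C] /= [sB tC] BCA].
  have [N vN NB] := IHs B sB; have [M vM MC] := IHt C tC.
  exists (fun x => N x `&` M x) => [x|v' NM]; first exact: filterI.
  by apply: (BCA (_, _)); split; [apply: NB|apply: MC] => x; case: (NM x).
- by move=> /(@invg_continuous G)/IHt[N vN NA]; exists N.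
Qed.

(* Neighbourhoods of valuations are boxes; for finite V this is the product
   topology. *)
Definition locally_decided (P : (V -> G) -> Prop) : Prop :=
  forall S : set (V -> G), S !=set0 ->
    exists v N, [/\ S v, forall x, nbhs (v x) (N x) &
      forall v', S v' -> (forall x, N x (v' x)) -> (P v' <-> P v)].

(** Decide [P] on a box around a point of [S], then decide [Q] on the part of [S] inside that box.
    Interiors are taken so that the first box is also a neighbourhood of the second point. *)
Lemma locally_decided_comb2 (P Q T : (V -> G) -> Prop) :
  (forall v v', (P v' <-> P v) -> (Q v' <-> Q v) -> (T v' <-> T v)) ->
  locally_decided P -> locally_decided Q -> locally_decided T.
Proof.
move=> PQT dP dQ S /dP[v [N [Sv vN NP]]].
have [|w [M [[Sw Nw] wM MQ]]] := dQ (S `&` [set w | forall x, (N x)^° (w x)]).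
  by exists v; split=> // x; exact: vN.
exists w, (fun x => (N x)^° `&` M x); split=> // [x|v' Sv' NM].
  by apply: filterI => //; apply: open_nbhs_nbhs; split; [exact: open_interior|].
have NPw := NP w Sw (fun x => interior_subset (Nw x)).
have NPv' := NP v' Sv' (fun x => interior_subset (NM x).1).
apply: PQT; first by rewrite NPw.
by apply: MQ => [|x]; [split=> // x; exact: (NM x).1|exact: (NM x).2].
Qed.

Lemma qf_locally_decided (R : realType) (f : qf_formula V) : completely_metrizable R G ->
  locally_decided (fun v => qf_holds v f).
Proof.
move=> [d [dm dT _]].
elim: f => [|s t|f dF|f dF g dH|f dF g dH|f dF g dH] /=.
- by move=> S [v Sv]; exists v, (fun=> setT); split=> // x; exact: filterT.
- move=> S [v0 Sv0].
  (* Either the equation holds throughout [S], or it fails at some point of [S] and then, as [G] is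
     Hausdorff, on a box around it. *)
  have [eqS|/existsNP[v /not_implyP[Sv vst]]] :=
    pselect (forall v, S v -> geval v s = geval v t).
    exists v0, (fun=> setT); split=> // [x|v Sv _]; first exact: filterT.
    by split=> _; exact: eqS.
  have [A [B [sA tB AB]]] := metric_separated dm dT vst.
  have [N vN NA] := geval_nbhs sA; have [M vM MB] := geval_nbhs tB.
  exists v, (fun x => N x `&` M x); split=> // [x|v' _ NM]; first exact: filterI.
  split=> // st; exfalso; apply: (AB (geval v' s)).
    by apply: NA => x; exact: (NM x).1.
  by rewrite st; apply: MB => x; exact: (NM x).2.
- by apply: (locally_decided_comb2 _ dF dF) => v v' /= ->.
- by apply: (locally_decided_comb2 _ dF dH) => v v' /= -> ->.
- by apply: (locally_decided_comb2 _ dF dH) => v v' /= -> ->.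
- by apply: (locally_decided_comb2 _ dF dH) => v v' /= -> ->.
Qed.

End LocalDecidability.

Section Condensation.
Variables (T : topologicalType) (W : Type) (n : nat) (a : W -> n.-tuple T).

(** Condensation points of the family [a], counted by indices: repeated values count separately. *)
Definition condensing : set W := [set w | forall N : 'I_n -> set T,
  (forall i, nbhs (tnth (a w) i) (N i)) ->
  ~ countable [set w' | forall i, N i (tnth (a w') i)]].

(** A non-condensing index lies in a box of network sets that catches only countably many indices,
    and there are only countably many such boxes. *)
Lemma countable_not_condensing (B : nat -> set T) :
  is_network B -> countable (~` condensing).
Proof.
move=> nB.
pose box (k : {ffun 'I_n -> nat}) := [set w | forall i, B (k i) (tnth (a w) i)].
apply: (@sub_countable _ _ _ (\bigcup_(k in [set k | countable (box k)]) box k)).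
  apply: subset_card_le => w /existsNP[N /not_implyP[aN /contrapT cN]].
  have /choice[k Bk] : forall i, exists k, B k (tnth (a w) i) /\ B k `<=` N i.
    by move=> i; have [k] := nB _ _ (aN i); exists k.
  exists [ffun i => k i]; last by move=> i; rewrite ffunE; exact: (Bk i).1.
  apply: sub_countable cN; apply: subset_card_le => w' + i => /(_ i).
  by rewrite ffunE; exact: (Bk i).2.
by apply: bigcup_countable => //; exact: countableP.
Qed.

End Condensation.

Lemma countable_setU (W : Type) (A C : set W) :
  countable A -> countable C -> countable (A `|` C).
Proof.
move=> cA cC; rewrite -bigcup2E; apply: bigcup_countable => [|i _].
  exact: countableP.
by case: i => [|[|i]] //=; exact: countable0.
Qed.

Lemma uncountable_meets (W : Type) (A C : set W) :
  ~ countable A -> countable (~` C) -> exists w, A w /\ C w.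
Proof.
move=> nA cC; apply: contrapT => /forallNP AC; apply: nA.
apply: sub_countable cC; apply: subset_card_le => w Aw Cw.
exact: (AC w).
Qed.

Theorem theorem1p1 (R : realType) (G : topologicalGroupType) (hG : polish R G)
    (n m : nat) (phi : qf_formula ('I_n + 'I_m))
    (d : Order.disp_t) (W : orderType d) (hW : is_omega1 W) :
  ~ defines_half_graph W G phi.
Proof.
case: hG => sepG mG; case: hW => _ uncW initW [a [b ab]].
have [B nB] : exists B : nat -> set G, is_network B.
  by case: mG => e [em eT _]; exact: separable_metric_network em eT sepG.
have co (C D : set W) : countable (~` C) -> countable (~` D) ->
    countable (~` (C `&` D)).
  by move=> cC cD; rewrite setCI; apply: countable_setU.
pose I := condensing a `&` condensing b.
have cI : countable (~` I) by apply: co; exact: countable_not_condensing nB.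
have [w0 [_ Iw0]] := uncountable_meets uncW cI.
pose S := [set v | exists al be, [/\ I al, I be & v = valuation (a al) (b be)]].
have [|v [N [[al [be [Ial Ibe ->]]] vN phiN]]] := qf_locally_decided phi mG (S := S).
  by exists (valuation (a w0) (b w0)), w0, w0.
have uncA := Ial.1 (fun i => N (inl i)) (fun i => vN (inl i)).
have uncB := Ibe.2 (fun j => N (inr j)) (fun j => vN (inr j)).
have const al' be' : I al' -> I be' -> (forall i, N (inl i) (tnth (a al') i)) ->
    (forall j, N (inr j) (tnth (b be') j)) -> (al' < be')%O <-> (al < be)%O.
  move=> Ial' Ibe' Na Nb; rewrite -!ab; apply: phiN; first by exists al', be'.
  by case.
have tailA be' : countable (~` [set w : W | (be' <= w)%O]).
  apply: sub_countable (initW be'); apply: subset_card_le => w /= /negP.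
  by rewrite -ltNge.
have tailB al' : countable (~` [set w : W | (al' < w)%O]).
  apply: (@sub_countable _ _ _ ([set w | (w < al')%O] `|` [set al'])).
    apply: subset_card_le => w /= /negP; rewrite -leNgt le_eqVlt.
    by move=> /predU1P[->|]; [right|left].
  by apply: countable_setU => //; exact: countable1.
(* Final segments are co-countable, so condensing indices with [be1 <= al1 < be2] can be chosen
   inside the box. There [const] carries the truth of [al1 < be2] over to [al1 < be1], which is
   false. *)
have [be1 [Nbe1 Ibe1]] := uncountable_meets uncB cI.
have [al1 [Nal1 [Ial1 be1al1]]] := uncountable_meets uncA (co _ _ cI (tailA be1)).
have [be2 [Nbe2 [Ibe2 al1be2]]] := uncountable_meets uncB (co _ _ cI (tailB al1)).
have /const : (al1 < be2)%O by [].
move=> /(_ Ial1 Ibe2 Nal1 Nbe2)/(const al1 be1 Ial1 Ibe1 Nal1 Nbe1).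
by rewrite ltNge be1al1.
Qed.
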